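(* Let $(a,b)\in\mathbb{R}^2$ with $a<b$ and let $f\in V([a,b];\mathbb{R})$. Then $$\lim_{\alpha\to 0^+}\left\|\mathcal{D}_a^\alpha f-\frac{df}{dx}\right\|_{L^1([a,b];\mathbb{R})}=0.$$
   Context: $V([a,b];\mathbb{R})=\left\{u\in C^1([a,b];\mathbb{R}): u(a)=\frac{du}{dx}(a)=0,\ u(b)=\frac{du}{dx}(b)=0\right\}$. Let $E_1(x)=\int_x^\infty \frac{e^{-t}}{t}\,dt$ for $x>0$. For $\alpha>0$ and $f\in L^1([a,b];\mathbb{R})$, let $$(J_a^\alpha f)(x)=\frac{1}{\alpha}\int_a^x E_1\left(\frac{x-t}{\alpha}\right)f(t)\,dt\quad\text{for a.e. } x\in[a,b].$$ A function in $L^1([a,b];\mathbb{R})$ has an absolutely continuous representative if it coincides a.e. on $[a,b]$ with an absolutely continuous function on $[a,b]$; it is then identified with that function. If $J_a^\alpha f$ has an absolutely continuous representative, the left-sided fractional derivative of order $\alpha$ of $f$ is $$(\mathcal{D}_a^\alpha f)(x)=\frac{d}{dx}(J_a^\alpha f)(x)\quad\text{for a.e. } x\in[a,b].$$ *)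

(* Defs.v *)
From HB Require Import structures.
From mathcomp Require Import all_boot all_order all_algebra.
From mathcomp Require Import all_classical all_reals all_analysis.
Set Implicit Arguments.
Unset Strict Implicit.
Unset Printing Implicit Defensive.
Import Order.TTheory GRing.Theory Num.Theory.
Import numFieldNormedType.Exports.

Local Open Scope classical_set_scope.
Local Open Scope ring_scope.

(* Functions on [a, b] are represented by total functions R -> R; every notion
   below only looks at their values on [a, b]. *)

(* The limit of the difference quotients is taken within [a, b], so that it is
   one-sided at the end points. *)
Definition diff_quotient (R : realType) (f : R -> R) (x y : R) : R :=
  (f y - f x) / (y - x).

Definition derivable_on (R : realType) (a b : R) (f : R -> R) (x : R) : Prop :=
  cvg (diff_quotient f x y @[y --> within `[a, b] x^']).

Definition deriv_on (R : realType) (a b : R) (f : R -> R) (x : R) : R :=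
  lim (diff_quotient f x y @[y --> within `[a, b] x^']).

Definition C1_on (R : realType) (a b : R) : set (R -> R) :=
  [set f | (forall x, x \in `[a, b] -> derivable_on a b f x) /\
           {within `[a, b], continuous (deriv_on a b f)}].

Definition V (R : realType) (a b : R) : set (R -> R) :=
  [set u | C1_on a b u /\
           (u a = 0 /\ deriv_on a b u a = 0) /\
           (u b = 0 /\ deriv_on a b u b = 0)].

(* Meaningful for 0 < x only; E1 0 is the real projection of +oo, i.e. 0, and
   is used below only on the null set {t = x}. *)
Definition E1 (R : realType) (x : R) : R :=
  \int[@lebesgue_measure R]_(t in `[x, +oo[) (expR (- t) / t).

Definition frac_int (R : realType) (a alpha : R) (f : R -> R) (x : R) : R :=
  alpha^-1 * \int[@lebesgue_measure R]_(t in `[a, x]) (E1 ((x - t) / alpha) * f t).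

(* Degenerate intervals x i = y i are allowed; they contribute 0 to both sums. *)
Definition absolutely_continuous_on (R : realType) (a b : R) (F : R -> R) : Prop :=
  forall e : R, 0 < e -> exists2 d : R, 0 < d &
    forall (n : nat) (x y : 'I_n -> R),
      (forall i, a <= x i /\ x i <= y i /\ y i <= b) ->
      trivIset [set: 'I_n] (fun i => `]x i, y i[%classic) ->
      \sum_(i < n) (y i - x i) < d ->
      \sum_(i < n) `|F (y i) - F (x i)| < e.

Definition is_ac_representative (R : realType) (a b : R) (h F : R -> R) : Prop :=
  absolutely_continuous_on a b F /\ ae_eq (@lebesgue_measure R) `[a, b]%classic F h.

Definition has_ac_representative (R : realType) (a b : R) (h : R -> R) : Prop :=
  exists F : R -> R, is_ac_representative a b h F.

(* Two absolutely continuous representatives agree everywhere on [a, b] when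
   a < b, so the choice made by xget does not matter there; without a
   representative the value is h itself. *)
Definition ac_representative (R : realType) (a b : R) (h : R -> R) : R -> R :=
  xget h [set F | is_ac_representative a b h F].

(* An absolutely continuous function is differentiable a.e.; on the exceptional
   null set, lim returns an arbitrary value. *)
Definition frac_deriv (R : realType) (a b alpha : R) (f : R -> R) : R -> R :=
  deriv_on a b (ac_representative a b (frac_int a alpha f)).

Definition L1_norm (R : realType) (a b : R) (h : R -> R) : \bar R :=
  'N[@lebesgue_measure R]_1[(EFin \o h) \_ `[a, b]]%E.

(* Main.v *)
Require Import Defs.
From HB Require Import structures.
From mathcomp Require Import all_boot all_order all_algebra.
From mathcomp Require Import all_classical all_reals all_analysis.
From mathcomp Require Import measurable_realfun ring lra.
Import Order.TTheory GRing.Theory Num.Theory.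
Import numFieldNormedType.Exports.

Local Open Scope classical_set_scope.
Local Open Scope ring_scope.

(* As f and f' vanish at both end points, composing them with the projection of
   the line onto [a, b] gives continuous functions f0, g0 on the line such that
   f0 has first-order expansions with slope g0, uniformly in the base point.
   The substitution t = x - alpha u turns J f (x) into the mean of
   f0 (x - alpha u) against E1 (u) du.  Since E1 is a probability density on
   [0, +oo[ (Tonelli), these expansions survive averaging: J f is Lipschitz and
   its derivative is the mean of g0 (x - alpha u).  This mean is uniformly close
   to g0 (x) because g0 is uniformly continuous and E1 has a finite first
   moment, as u E1 (u) <= e^-u. *)

(** * Affine substitution in Lebesgue integrals *)

Definition affine_reflect (R : realType) (c r : R) :
  measurableTypeR R -> measurableTypeR R := fun u => c - r * u.

Lemma measurable_affine_reflect (R : realType) (c r : R) :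
  measurable_fun [set: measurableTypeR R] (affine_reflect R c r).
Proof.
by apply: measurable_funB => //; exact: measurable_funM.
Qed.

(** Scaled by [r], the image of Lebesgue measure under [u |-> c - r * u] gives half-open intervals
    their length, so it is Lebesgue measure by uniqueness. *)
Lemma ge0_integral_affine_reflect (R : realType) (c r : R) (h : R -> \bar R) :
  0 < r -> measurable_fun setT h -> (forall x, 0 <= h x)%E ->
  (r%:E * \int[@lebesgue_measure R]_u h (c - r * u)%R =
   \int[@lebesgue_measure R]_t h t)%E.
Proof.
move=> r0 mh h0.
have mphi := measurable_affine_reflect R c r.
pose push (mf : measurable_fun setT (affine_reflect R c r)) :
  {measure set (measurableTypeR R) -> \bar R} :=
  ltac:(refine (pushforward (@lebesgue_measure R) (affine_reflect R c r));
        exact mf).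
pose m : {measure set (measurableTypeR R) -> \bar R} :=
  mscale (NngNum (ltW r0)) (push mphi).
have mE : forall A, measurable A -> lebesgue_measure A = m A.
  apply: lebesgue_measure_unique => _ [[a b] _ <-].
  rewrite -[RHS]/
    (r%:E * lebesgue_measure (affine_reflect R c r @^-1` `]a, b]))%E.
  (* The reflection reverses order, so the closed end moves to the left; lengths do not see this. *)
  have -> : affine_reflect R c r @^-1` `]a, b] =
      `[(c - b) / r, (c - a) / r[%classic.
    apply/seteqP; split=> u /=; rewrite !in_itv/= ler_pdivrMr// ltr_pdivlMr//;
      rewrite /affine_reflect mulrC => /andP[? ?]; apply/andP; split; lra.
  rewrite !lebesgue_measure_itv/= !lte_fin ltr_pM2r ?invr_gt0// ltrD2l ltrN2.
  case: ifPn => // ab; last by rewrite mule0.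
  rewrite -!EFinD -EFinM; congr _%:E; field; exact: lt0r_neq0.
have -> : (\int[lebesgue_measure]_u h (c - r * u)%R =
   \int[push mphi]_t h t)%E.
  by rewrite [RHS]ge0_integral_pushforward.
rewrite -[X in (X%:E * _)%E]/((NngNum (ltW r0))%:num).
rewrite -ge0_integral_mscale//.
by apply: eq_measure_integral => A mA _; exact/esym/mE.
Qed.

(** Integrability is not assumed: positive and negative parts are transferred separately, and a
    factor [r > 0] preserves infinite values, whose real part is 0 on both sides. *)
Lemma Rintegral_affine_reflect (R : realType) (c r : R) (h : R -> R) :
  0 < r -> measurable_fun setT h ->
  r * \int[@lebesgue_measure R]_u h (c - r * u) =
  \int[@lebesgue_measure R]_t h t.
Proof.
move=> r0 mh; rewrite /Rintegral.
have mhE : measurable_fun setT (EFin \o h) by exact/measurable_EFinP.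
suff <- : (r%:E * \int[@lebesgue_measure R]_u (h (c - r * u)%R)%:E =
   \int[@lebesgue_measure R]_t (h t)%:E)%E.
  by case: (integral _ _ _) => [x| |] //=;
    rewrite ?gt0_muley ?gt0_muleNy ?lte_fin//= mulr0.
rewrite [in LHS]integralE [in RHS]integralE.
rewrite -(ge0_integral_affine_reflect R c r
  (fun t => (EFin \o h)^\+ t)%E)//; last first.
  exact: measurable_funepos.
rewrite -(ge0_integral_affine_reflect R c r
  (fun t => (EFin \o h)^\- t)%E)//; last first.
  exact: measurable_funeneg.
have pE : (\int[lebesgue_measure]_u (fun u => (h (c - r * u))%:E)^\+ u =
    \int[lebesgue_measure]_u (EFin \o h)^\+ (c - r * u)%R)%E.
  by apply: eq_integral => u _; rewrite !funeposE.
have nE : (\int[lebesgue_measure]_u (fun u => (h (c - r * u))%:E)^\- u =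
    \int[lebesgue_measure]_u (EFin \o h)^\- (c - r * u)%R)%E.
  by apply: eq_integral => u _; rewrite !funenegE.
rewrite pE nE.
case: (integral _ _ _) => [x| |]; case: (integral _ _ _) => [y| |] //=;
  rewrite -?EFinM ?gt0_muley ?gt0_muleNy ?lte_fin//= -?EFinD -?EFinM ?mulrBr//.
Qed.

(** * [E1] as a probability density with finite first moment *)

Lemma integral_expRN_itvy (R : realType) (u : R) :
  (\int[@lebesgue_measure R]_(t in `[u, +oo[) (expR (- t))%:E =
   (expR (- u))%:E)%E.
Proof.
have dF (t : R) : is_derive t 1 (fun s : R => - expR (- s)) (expR (- t)).
  by apply: is_derive_eq; rewrite -[LHS]/(- (expR (- t) * - 1)) mulrN1 opprK.
have cF : continuous (fun s : R => - expR (- s)).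
  by move=> t; apply/differentiable_continuous/derivable1_diffP; case: (dF t).
rewrite (@ge0_continuous_FTC2y _ _ (fun s => - expR (- s)) u 0).
- by rewrite sub0e EFinN oppeK.
- by move=> t _; exact: expR_ge0.
- apply: continuous_subspaceT => t.
  apply: continuous_comp; [exact: oppr_continuous|exact: continuous_expR].
- by rewrite -oppr0; apply: cvgN; exact: cvgr_expR.
- by move=> t _; case: (dF t).
- by apply/cvg_at_right_filter; exact: cF.
- by move=> t _; rewrite derive1E; exact: derive_val.
Qed.

(** Extended by 0 to the whole line, so that Tonelli applies on the full plane. *)
Definition E1_density (R : realType) : R -> R :=
  (fun t => expR (- t) / t) \_ `]0, +oo[.

Lemma E1_densityE (R : realType) (t : R) : 0 <= t ->
  E1_density R t = expR (- t) / t.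
Proof.
rewrite /E1_density patchE le_eqVlt => /predU1P[<-|t0].
  (* At [t = 0] both sides are 0, the inverse of 0 being 0. *)
  by rewrite invr0 mulr0; case: ifP.
by rewrite ifT// inE/= in_itv/= t0.
Qed.

Lemma E1_density_ge0 (R : realType) (t : R) : 0 <= E1_density R t.
Proof.
rewrite /E1_density patchE; case: ifPn => //.
by rewrite inE/= in_itv/= andbT => t0; rewrite divr_ge0// ?expR_ge0// ltW.
Qed.

Lemma measurable_E1_density (R : realType) :
  measurable_fun [set: R] (E1_density R).
Proof.
apply/measurable_restrict => //; rewrite setTI.
apply: open_continuous_measurable_fun; first exact: interval_open.
move=> t; rewrite inE/= in_itv/= andbT => t0.
apply: cvgM.
  apply: continuous_comp; [exact: oppr_continuous|exact: continuous_expR].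
by apply: cvgV => //; exact: lt0r_neq0.
Qed.

(** The range [u <= t] of the integral defining [E1] becomes an indicator on the plane. For
    [u, t > 0], integrating out [t] gives [E1 u] and integrating out [u] gives [expR (- t)]. *)
Definition E1_kernel (R : realType)
    (p : measurableTypeR R * measurableTypeR R) : \bar R :=
  (E1_density R p.2 * \1_[set q : measurableTypeR R * measurableTypeR R |
     (0 <= q.1) && (q.1 <= q.2)] p)%:E.

Lemma E1_kernel_ge0 (R : realType) p : (0 <= E1_kernel R p)%E.
Proof. by rewrite lee_fin mulr_ge0// E1_density_ge0. Qed.

Lemma measurable_E1_kernel (R : realType) :
  measurable_fun setT (E1_kernel R).
Proof.
apply/measurable_EFinP/measurable_funM.
  by apply: measurableT_comp => //; exact: measurable_E1_density.
apply: measurable_indic.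
pose b (p : measurableTypeR R * measurableTypeR R) :=
  ((0 : R) <= p.1) && ((p.1 : R) <= p.2).
have : measurable_fun setT b.
  by apply: measurable_and; exact: measurable_fun_ler.
by move=> /(_ measurableT [set true]); rewrite setTI; exact.
Qed.

Lemma integral_E1_kernel_snd (R : realType) (u : R) : 0 <= u ->
  (\int[@lebesgue_measure R]_t E1_kernel R (u, t) =
   \int[@lebesgue_measure R]_(t in `[u, +oo[) (expR (- t) / t)%:E)%E.
Proof.
move=> u0; rewrite [RHS]integral_mkcond; apply: eq_integral => t _.
rewrite /E1_kernel patchE indicE/=; have [ut|ut] := leP u t.
  rewrite !mem_set/= ?in_itv/= ?u0 ?ut// mulr1 E1_densityE//.
  exact: le_trans ut.
by rewrite !memNset/= ?in_itv/= ?mulr0// ?andbT; apply/negP;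
  rewrite ?u0 -ltNge.
Qed.

Lemma E1_fine (R : realType) (u : R) : 0 <= u ->
  E1 u = fine (\int[@lebesgue_measure R]_t E1_kernel R (u, t)).
Proof. by move=> u0; rewrite integral_E1_kernel_snd. Qed.

Lemma E1_ge0 (R : realType) (u : R) : 0 <= u -> 0 <= E1 u.
Proof.
move=> u0; apply: Rintegral_ge0 => t/=; rewrite in_itv/= andbT => ut.
by rewrite divr_ge0// ?expR_ge0//; exact: le_trans ut.
Qed.

Lemma measurable_E1 (R : realType) :
  measurable_fun (`[0, +oo[%classic : set R) (@E1 R).
Proof.
apply: (@eq_measurable_fun _ _ _ _ _ (fun u =>
  fine (\int[@lebesgue_measure R]_t E1_kernel R (u, t)))).
  by move=> u; rewrite inE/= in_itv/= andbT => u0; rewrite E1_fine.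
apply/measurable_funTS/measurableT_comp => //.
exact: (measurable_fun_fubini_tonelli_F _ (measurable_E1_kernel R)
  (E1_kernel_ge0 R)).
Qed.

(** On the range [t >= u] the factor [u / t] is at most 1. The extended-real form also serves to
    prove that the integral is finite. *)
Lemma mul_E1_le (R : realType) (u : R) : 0 < u ->
  (u%:E * \int[@lebesgue_measure R]_t E1_kernel R (u, t) <=
   (expR (- u))%:E)%E.
Proof.
move=> u0; rewrite integral_E1_kernel_snd ?(ltW u0)//.
have t0 t : `[u, +oo[%classic t -> 0 < t.
  by rewrite /= in_itv/= andbT; exact: lt_le_trans.
have mk : measurable_fun `[u, +oo[ (fun t : R => (expR (- t) / t)%:E).
  apply/measurable_EFinP.
  apply: (@eq_measurable_fun _ _ _ _ _ (E1_density R)).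
    by move=> t; rewrite inE => /t0 /ltW tp; exact: E1_densityE.
  by apply: measurable_funTS; exact: measurable_E1_density.
rewrite -ge0_integralZl//; last 2 first.
- by move=> t /t0 tp; rewrite lee_fin divr_ge0// ?expR_ge0// ltW.
- by rewrite lee_fin ltW.
rewrite -integral_expRN_itvy; apply: ge0_le_integral => //.
- move=> t /t0 tp; rewrite -EFinM lee_fin.
  by rewrite mulr_ge0 ?divr_ge0// ?expR_ge0// ltW.
- exact: measurable_funeM.
- by apply/measurable_EFinP/measurable_funTS/measurableT_comp => //.
- move=> t /[dup] /t0 tp; rewrite /= in_itv/= andbT => ut.
  by rewrite -EFinM lee_fin mulrCA ler_piMr ?expR_ge0// ler_pdivrMr// mul1r.
Qed.

(** An infinite integral would stay infinite after multiplication by [u > 0], against the bound by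
    [expR (- u)]. *)
Lemma E1_kernel_fin_num (R : realType) (u : R) : 0 < u ->
  (\int[@lebesgue_measure R]_t E1_kernel R (u, t) \is a fin_num)%E.
Proof.
move=> u0; rewrite ge0_fin_numE; last first.
  by apply: integral_ge0 => t _; exact: E1_kernel_ge0.
have := mul_E1_le R u u0.
by case: (integral _ _ _) => [x _| |] //; [exact: ltry|rewrite gt0_muley].
Qed.

Lemma mulr_E1_le (R : realType) (u : R) : 0 <= u -> u * E1 u <= expR (- u).
Proof.
rewrite le_eqVlt => /predU1P[<-|u0]; first by rewrite mul0r expR_ge0.
rewrite E1_fine ?(ltW u0)// -lee_fin EFinM fineK ?E1_kernel_fin_num//.
exact: mul_E1_le.
Qed.

(** By Tonelli, the mass of [E1] is the integral of [expR (- t) / t] times the length [t] of the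
    slice [[0, t]], that is, of [expR (- t)]. *)
Lemma integral_E1 (R : realType) :
  (\int[@lebesgue_measure R]_(u in `[0%R, +oo[) (E1 u)%:E = 1)%E.
Proof.
(* The null set {0} is set aside because the kernel integral is known to be finite for [u > 0]
   only. *)
rewrite -(@integral_itv_obnd_cbnd _ 0); last first.
  apply/measurable_EFinP; apply: measurable_funS (measurable_E1 R) => //.
  by apply: subset_itvr; rewrite bnd_simp.
transitivity (\int[@lebesgue_measure R]_(u in `]0%R, +oo[)
    \int[@lebesgue_measure R]_t E1_kernel R (u, t))%E.
  apply: eq_integral => u; rewrite inE/= in_itv/= andbT => u0.
  by rewrite E1_fine ?(ltW u0)// fineK ?E1_kernel_fin_num.
rewrite integral_itv_obnd_cbnd; last first.
  apply/measurable_funTS.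
  exact: (measurable_fun_fubini_tonelli_F _ (measurable_E1_kernel R)
    (E1_kernel_ge0 R)).
transitivity (\int[@lebesgue_measure R]_u
    \int[@lebesgue_measure R]_t E1_kernel R (u, t))%E.
  rewrite integral_mkcond; apply: eq_integral => u _.
  rewrite patchE; have [u0|u0] := leP 0 (u : R).
    by rewrite mem_set//= in_itv/= u0.
  rewrite memNset//= ?in_itv/= ?andbT; last by apply/negP; rewrite -ltNge.
  rewrite integral0_eq// => t _; rewrite /E1_kernel indicE memNset/= ?mulr0//.
  by rewrite leNgt u0.
rewrite fubini_tonelli//; [|exact: measurable_E1_kernel|exact: E1_kernel_ge0].
transitivity (\int[@lebesgue_measure R]_(t in `]0%R, +oo[) (expR (- t))%:E)%E.
  rewrite [RHS]integral_mkcond; apply: eq_integral => t _.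
  rewrite patchE; have [t0|t0] := ltP 0 (t : R); last first.
    have tN : ~ `]0, +oo[%classic (t : R).
      by rewrite /= in_itv/= andbT; apply/negP; rewrite -leNgt.
    rewrite memNset// integral0_eq// => u _.
    by rewrite /E1_kernel/= /E1_density patchE memNset ?mul0r.
  rewrite mem_set/= ?in_itv/= ?t0//.
  transitivity (\int[@lebesgue_measure R]_u
      ((E1_density R t)%:E * (\1_`[0%R, t] u)%:E))%E.
    apply: eq_integral => u _; rewrite /E1_kernel EFinM !indicE/=.
    have uE : ((u : R) \in `[0, t : R]) = (0 <= (u : R)) && ((u : R) <= t).
      by rewrite in_itv.
    have [uI|/negP uI] := boolP ((u : R) \in `[0, t : R]).
      by rewrite !mem_set//= -uE.
    by rewrite !memNset//= -uE.
  rewrite ge0_integralZl//=; last 2 first.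
  - by apply/measurable_EFinP/measurable_indic.
  - by rewrite lee_fin E1_density_ge0.
  have muI : lebesgue_measure (`[0, t : R]%classic : set R) = (t : R)%:E.
    by rewrite lebesgue_measure_itv/= lte_fin t0 -EFinB subr0.
  rewrite integral_indic// setIT [X in (_ * X)%E]muI.
  by rewrite -EFinM E1_densityE ?ltW// divfK// lt0r_neq0.
rewrite integral_itv_obnd_cbnd; last first.
  by apply/measurable_EFinP/measurable_funTS/measurableT_comp.
by rewrite integral_expRN_itvy oppr0 expR0.
Qed.

(** * Means against [E1] *)

Definition E1_mean (R : realType) (phi : R -> R) : R :=
  \int[@lebesgue_measure R]_(u in `[0, +oo[) (E1 u * phi u).

Lemma integrable_E1 (R : realType) :
  (@lebesgue_measure R).-integrable `[0, +oo[ (EFin \o @E1 R).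
Proof.
apply/integrableP; split.
  by apply/measurable_EFinP; exact: measurable_E1.
rewrite [X in (X < _)%E](_ : _ = 1%E) ?ltry// -(integral_E1 R).
apply: eq_integral => u; rewrite inE/= in_itv/= andbT => u0.
by rewrite ger0_norm// E1_ge0.
Qed.

Lemma integrable_expRN (R : realType) :
  (@lebesgue_measure R).-integrable `[0, +oo[ (fun u : R => (expR (- u))%:E).
Proof.
apply/integrableP; split.
  by apply/measurable_EFinP/measurable_funTS/measurableT_comp.
rewrite [X in (X < _)%E](_ : _ = (expR (- 0))%:E) ?ltry//.
rewrite -integral_expRN_itvy; apply: eq_integral => u _.
by rewrite /= ger0_norm// expR_ge0.
Qed.

(** Affine growth of [phi] is admissible because [u * E1 u <= expR (- u)] replaces the moment of
    [E1] by an exponential of known integral. *)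
Lemma norm_E1_mul_le (R : realType) (p q : R) (phi : R -> R) (u : R) :
  0 <= q -> (forall u, 0 <= u -> `|phi u| <= p + q * u) -> 0 <= u ->
  `|E1 u * phi u| <= p * E1 u + q * expR (- u).
Proof.
move=> q0 phipq u0; rewrite normrM ger0_norm ?E1_ge0//.
apply: (le_trans (ler_wpM2l (E1_ge0 R u u0) (phipq u u0))).
rewrite mulrDr mulrC lerD2l mulrCA; apply: ler_wpM2l => //.
by rewrite mulrC mulr_E1_le.
Qed.

Lemma integrable_E1_bound (R : realType) (p q : R) :
  (@lebesgue_measure R).-integrable `[0, +oo[
    (fun u => (p * E1 u + q * expR (- u))%:E).
Proof.
have mD : measurable (`[0, +oo[%classic : set (measurableTypeR R)) by [].
exact: (integrableD mD (integrableZl mD p (integrable_E1 R))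
  (integrableZl mD q (integrable_expRN R))).
Qed.

Lemma integrable_E1_mul (R : realType) (p q : R) (phi : R -> R) :
  0 <= q -> measurable_fun setT phi ->
  (forall u, 0 <= u -> `|phi u| <= p + q * u) ->
  (@lebesgue_measure R).-integrable `[0, +oo[ (fun u => (E1 u * phi u)%:E).
Proof.
move=> q0 mphi phipq; apply: le_integrable (integrable_E1_bound R p q) => //.
  apply/measurable_EFinP/measurable_funM; first exact: measurable_E1.
  exact: measurable_funTS.
move=> u /=; rewrite in_itv/= andbT => u0; rewrite lee_fin.
by apply: le_trans (ler_norm _); exact: norm_E1_mul_le.
Qed.

(** The dominating function [p * E1 u + q * expR (- u)] has integral [p + q], both masses being 1.
    With [q = 0] uniform bounds pass to means; the linear term serves the limit in [alpha]. *)
Lemma le_norm_E1_mean (R : realType) (p q : R) (phi : R -> R) :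
  0 <= q -> measurable_fun setT phi ->
  (forall u, 0 <= u -> `|phi u| <= p + q * u) ->
  `|E1_mean R phi| <= p + q.
Proof.
move=> q0 mphi phipq; have ip := integrable_E1_mul R p q phi q0 mphi phipq.
apply: (le_trans (le_normr_Rintegral _ ip)) => //.
apply: (@le_trans _ _ (\int[@lebesgue_measure R]_(u in `[0, +oo[)
   (p * E1 u + q * expR (- u)))).
  apply: le_Rintegral => //.
  - exact: (integrable_norm ip).
  - exact: integrable_E1_bound.
  - by move=> u /=; rewrite in_itv/= andbT => u0; exact: norm_E1_mul_le.
rewrite RintegralD//; last 2 first.
- by apply: (integrableZl _ p (integrable_E1 R)).
- by apply: (integrableZl _ q (integrable_expRN R)).
rewrite !RintegralZl//; [|exact: integrable_expRN|exact: integrable_E1].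
rewrite /Rintegral integral_E1 integral_expRN_itvy oppr0 expR0.
by rewrite !mulr1.
Qed.

Lemma E1_mean_cst (R : realType) (c : R) : E1_mean R (cst c) = c.
Proof.
rewrite /E1_mean/= RintegralZr//; last exact: integrable_E1.
by rewrite /Rintegral integral_E1 mul1r.
Qed.

(** The growth bound supplies the integrability that linearity of the integral requires. *)
Lemma E1_meanZr (R : realType) (p q c : R) (phi : R -> R) :
  0 <= q -> measurable_fun setT phi ->
  (forall u, 0 <= u -> `|phi u| <= p + q * u) ->
  E1_mean R (fun u => phi u * c) = E1_mean R phi * c.
Proof.
move=> q0 mphi phipq; rewrite /E1_mean -RintegralZr//; last first.
  exact: (integrable_E1_mul R p q).
by apply: eq_Rintegral => u _; rewrite mulrA.
Qed.

Lemma E1_meanB (R : realType) (p q r s : R) (phi psi : R -> R) :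
  0 <= q -> measurable_fun setT phi ->
  (forall u, 0 <= u -> `|phi u| <= p + q * u) ->
  0 <= s -> measurable_fun setT psi ->
  (forall u, 0 <= u -> `|psi u| <= r + s * u) ->
  E1_mean R (fun u => phi u - psi u) = E1_mean R phi - E1_mean R psi.
Proof.
move=> q0 mphi phipq s0 mpsi psirs; rewrite /E1_mean -RintegralB//.
- by apply: eq_Rintegral => u _; rewrite mulrBr.
- exact: (integrable_E1_mul R p q).
- exact: (integrable_E1_mul R r s).
Qed.

(** The substitution [t = x - alpha * u] cancels [alpha^-1]. It sends [[a, x]] to a bounded range of
    [u], and the vanishing of [F] to the left of [a] allows the whole half-line instead. *)
Lemma frac_int_E1_mean (R : realType) (a alpha x : R) (f F : R -> R) :
  0 < alpha -> measurable_fun setT F ->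
  (forall t, t < a -> F t = 0) -> (forall t, a <= t <= x -> f t = F t) ->
  frac_int a alpha f x = E1_mean R (fun u => F (x - alpha * u)).
Proof.
move=> alpha0 mF F0 fF.
(* Cutting [E1] off at negative arguments discards the part [t > x] of the line. *)
pose E := (@E1 R) \_ `[0, +oo[.
have mE : measurable_fun setT E.
  by apply/measurable_restrict => //; rewrite setTI; exact: measurable_E1.
pose h t := E ((x - t) / alpha) * F t.
have mh : measurable_fun setT h.
  apply: measurable_funM => //; apply: measurableT_comp => //.
  by apply: measurable_funM => //; exact: measurable_funB.
rewrite /frac_int Rintegral_mkcond.
rewrite (_ : \int[lebesgue_measure]_t _ = \int[@lebesgue_measure R]_t h t).
  rewrite -(Rintegral_affine_reflect R x alpha h)// mulKf ?gt_eqF//.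
  rewrite /E1_mean [RHS]Rintegral_mkcond; apply: eq_Rintegral => u _.
  rewrite /h (_ : (x - (x - alpha * u)) / alpha = u); last first.
    by field; rewrite gt_eqF.
  by rewrite /E !patchE; case: ifP; rewrite // mul0r.
apply: eq_Rintegral => t _; rewrite /h /E !patchE.
have [tx|xt] := leP t x; last first.
  rewrite memNset/=; last by rewrite in_itv/= => /andP[_]; rewrite leNgt xt.
  rewrite memNset ?mul0r//= in_itv/= andbT; apply/negP; rewrite -ltNge.
  by rewrite pmulr_llt0 ?invr_gt0// subr_lt0.
rewrite [X in _ = X * _]ifT; last first.
  by rewrite mem_set//= in_itv/= andbT divr_ge0 ?subr_ge0// ltW.
have [at_|ta] := leP a t; first by rewrite mem_set/= ?in_itv/= ?at_// fF ?at_.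
rewrite memNset/=; last by rewrite in_itv/= leNgt ta.
by rewrite F0// mulr0.
Qed.

(** * Derivatives within [[a, b]] as first-order expansions without division *)

Lemma diff_quotient_cvgP (R : realType) (a b : R) (f : R -> R) (x l : R) :
  (diff_quotient f x y @[y --> within `[a, b] x^'] --> l) <->
  (forall e, 0 < e -> exists2 d, 0 < d & forall y, a <= y <= b ->
     `|y - x| < d -> `|f y - f x - l * (y - x)| <= e * `|y - x|).
Proof.
split=> [/cvgrPdist_le fl e e0|fl].
  have := fl e e0; rewrite /within/= near_withinE => -[d /= d0 dP].
  (* The difference quotient excludes [y = x], where the inequality without division is trivial. *)
  exists d => // y yab yx; have [->|yneqx] := eqVneq y x.
    by rewrite !subrr mulr0 subrr normr0 mulr0.
  have := dP y; rewrite /ball_/= distrC => /(_ yx yneqx).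
  rewrite in_itv/= => /(_ yab).
  have yx0 : y - x != 0 by rewrite subr_eq0.
  rewrite /diff_quotient distrC -(ler_pM2r (x := `|y - x|)) ?normr_gt0//.
  by rewrite -normrM mulrBl divfK.
apply/cvgrPdist_le => e e0; rewrite near_withinE.
have [d d0 dP] := fl e e0.
exists d => // y /=; rewrite distrC => yx yneqx; rewrite in_itv/= => yab.
have yx0 : y - x != 0 by rewrite subr_eq0.
rewrite /diff_quotient distrC -(ler_pM2r (x := `|y - x|)) ?normr_gt0//.
by rewrite -normrM mulrBl divfK//; exact: dP.
Qed.

(** The subinterval is nondegenerate even when [x] is an end point. It provides points other than
    [x], and a set of positive measure, close to [x]. *)
Lemma subitv_near (R : realType) (a b x d : R) :
  a < b -> a <= x <= b -> 0 < d ->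
  exists p q, [/\ p < q, a <= p, q <= b &
    forall y, p <= y <= q -> `|y - x| < d].
Proof.
move=> ab /andP[ax xb] d0.
exists (Num.max a (x - d / 2)), (Num.min b (x + d / 2)).
have d20 : 0 < d / 2 by rewrite divr_gt0.
split.
- by rewrite gt_max !lt_min ab /=; apply/and3P; split; lra.
- by rewrite le_max lexx.
- by rewrite ge_min lexx.
- move=> y; rewrite ge_max le_min -andbA => /and4P[_ ? _ ?].
  by rewrite ltr_norml; apply/andP; split; lra.
Qed.

(** Properness makes limits within [[a, b]] unique, end points included. It holds because the ends
    [p < q] of a small subinterval cannot both equal [x]. *)
Lemma within_itv_dnbhs_proper (R : realType) (a b x : R) : a < b ->
  a <= x <= b -> ProperFilter (within `[a, b] x^').
Proof.
move=> ab xab; split; last exact: within_filter.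
move=> [d /= d0 dP].
have [p [q [pq ap qb pqd]]] := subitv_near R a b x d ab xab d0.
have outside y : p <= y <= q -> y != x -> False.
  move=> ypq yx; apply: (dP y) => //=; first by rewrite distrC; exact: pqd.
  have /andP[py yq] := ypq.
  by rewrite in_itv/= (le_trans ap py) (le_trans yq qb).
have [px|] := eqVneq p x; last by apply: outside; rewrite lexx ltW.
by apply: (outside q); rewrite ?lexx ?(ltW pq)// -px gt_eqF.
Qed.

Lemma deriv_on_eq (R : realType) (a b : R) (f : R -> R) (x l : R) :
  a < b -> a <= x <= b ->
  (forall e, 0 < e -> exists2 d, 0 < d & forall y, a <= y <= b ->
     `|y - x| < d -> `|f y - f x - l * (y - x)| <= e * `|y - x|) ->
  deriv_on a b f x = l.
Proof.
move=> ab xab /diff_quotient_cvgP fl.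
have PF := within_itv_dnbhs_proper R a b x ab xab.
by apply/cvg_lim.
Qed.

Lemma deriv_onP (R : realType) (a b : R) (f : R -> R) (x : R) :
  derivable_on a b f x ->
  (forall e, 0 < e -> exists2 d, 0 < d & forall y, a <= y <= b ->
     `|y - x| < d ->
     `|f y - f x - deriv_on a b f x * (y - x)| <= e * `|y - x|).
Proof. by move=> df; apply/diff_quotient_cvgP; exact: df. Qed.

(** * Projection onto [[a, b]], uniform continuity and bounds *)

Definition clamp (R : realType) (a b x : R) : R := Num.max a (Num.min b x).

Lemma clamp_bound (R : realType) (a b x : R) : a <= b ->
  a <= clamp R a b x <= b.
Proof. by move=> ab; rewrite /clamp le_max lexx/= ge_max ab/= ge_min lexx. Qed.

Lemma clamp_id (R : realType) (a b x : R) : a <= x <= b -> clamp R a b x = x.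
Proof.
by move=> /andP[ax xb]; rewrite /clamp (min_idPr xb) (max_idPr ax).
Qed.

Lemma clamp_left (R : realType) (a b x : R) : x <= a -> a <= b ->
  clamp R a b x = a.
Proof.
by move=> xa ab; rewrite /clamp (min_idPr (le_trans xa ab)) (max_idPl xa).
Qed.

Lemma clamp_right (R : realType) (a b x : R) : b <= x -> a <= b ->
  clamp R a b x = b.
Proof.
by move=> bx ab; rewrite /clamp (min_idPl bx) (max_idPr ab).
Qed.

Lemma clamp_lipschitz (R : realType) (a b x y : R) : a <= b ->
  `|clamp R a b y - clamp R a b x| <= `|y - x|.
Proof.
move=> ab; rewrite /clamp.
case: (leP b x) => bx; case: (leP b y) => by_; rewrite ?(max_idPr ab) ?subrr//;
  (try case: (leP a x) => ax); (try case: (leP a y) => ay); rewrite ?subrr//;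
  rewrite ler_norml; case: (ler0P (y - x)) => xy; apply/andP; split; lra.
Qed.

(** The projection is 1-Lipschitz with values in [[a, b]], so continuity within the interval is
    enough. *)
Lemma continuous_clamp (R : realType) (a b : R) (h : R -> R) : a <= b ->
  {within `[a, b], continuous h} -> continuous (h \o clamp R a b).
Proof.
move=> ab /subspace_continuousP ch x.
have xab := clamp_bound R a b x ab.
apply/cvgrPdist_le => e e0.
have /cvgrPdist_le /(_ e e0) := ch (clamp R a b x) ltac:(by rewrite /= in_itv).
rewrite near_withinE => -[d /= d0 dP]; exists d => // y /= yx.
apply: dP; last by rewrite /= in_itv/= clamp_bound.
by apply: le_lt_trans yx; exact: clamp_lipschitz.
Qed.

(** Local moduli of continuity are merged by compactness of [[a, b]] in near-covering form; only the
    base point [x] is confined to the interval. *)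
Lemma uniform_continuity_itv (R : realType) (a b : R) (h : R -> R) :
  continuous h -> forall e, 0 < e -> exists2 d, 0 < d &
    forall x y, a <= x <= b -> `|y - x| < d -> `|h y - h x| <= e.
Proof.
move=> ch e e0.
have /compact_near_coveringP cov := @segment_compact R a b.
have [|d /= d0 dP] := cov R (0 : R)^'+ (fun d x =>
    forall y, `|y - x| < d -> `|h y - h x| <= e) _.
  move=> x _.
  have e20 : 0 < e / 2 by rewrite divr_gt0.
  have /cvgrPdist_le/(_ _ e20)[r /= r0 rP] := ch x.
  (* One half of [r] covers the move from [x] to [x'], the other the move from [x'] to [y]. *)
  have r20 : 0 < r / 2 by rewrite divr_gt0.
  exists (ball x (r / 2), [set d | d < r / 2]) => /=.
    by split; [exact: nbhsx_ballx|exact: nbhs_right_lt].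
  move=> [x' d] [/= xx' dr] y yx'.
  have hx' : `|h x - h x'| <= e / 2.
    by apply: rP; rewrite /= (lt_trans xx')//; lra.
  have hy : `|h x - h y| <= e / 2.
    apply: rP => /=; apply: (le_lt_trans (ler_distD x' x y)).
    rewrite (distrC x' y) [ltRHS]splitr; apply: ltrD; first exact: xx'.
    exact: lt_trans dr.
  rewrite -(subrK (h x) (h y)) -addrA (le_trans (ler_normD _ _))//.
  by rewrite distrC; lra.
exists (d / 2); first by rewrite divr_gt0.
move=> x y xab yx; apply: (dP (d / 2)) => //=.
- by rewrite sub0r normrN gtr0_norm ?divr_gt0//; lra.
- by rewrite divr_gt0.
Qed.

Lemma bounded_itv (R : realType) (a b : R) (h : R -> R) : a <= b ->
  continuous h -> exists M, forall x, a <= x <= b -> `|h x| <= M.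
Proof.
move=> ab ch.
have [|c _ cP] := @EVT_max R (fun x => `|h x|) a b ab.
  apply: continuous_subspaceT => x; apply: continuous_comp; first exact: ch.
  exact: norm_continuous.
by exists `|h c| => x xab; apply: cP; rewrite in_itv.
Qed.

(** Leads back from expansions to the two-sided derivative that the mean value theorem takes as
    input. *)
Lemma is_derive1_linear_approx (R : realType) (f : R -> R) (x l : R) :
  (forall e, 0 < e -> exists2 d, 0 < d & forall y,
     `|y - x| < d -> `|f y - f x - l * (y - x)| <= e * `|y - x|) ->
  is_derive x 1 f l.
Proof.
move=> fl.
have cl : h^-1 *: (f (h *: 1 + x) - f x) @[h --> (0 : R)^'] --> l.
  apply/cvgrPdist_le => e e0; have [d d0 dP] := fl e e0.
  exists d => // h /=; rewrite sub0r normrN => hd h0.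
  have hn0 : 0 < `|h| by rewrite normr_gt0.
  rewrite /GRing.scale/= mulr1 distrC -(ler_pM2r hn0) -normrM mulrBl mulrC.
  rewrite mulrA divff// mul1r.
  by have := dP (h + x); rewrite addrK; exact.
by apply: DeriveDef; [apply/cvg_ex; exists l|apply: cvg_lim => //].
Qed.

(** * Absolute continuity and uniqueness of the representative *)

Lemma lipschitz_absolutely_continuous (R : realType) (a b M : R) (F : R -> R) :
  0 <= M -> (forall x y, `|F y - F x| <= M * `|y - x|) ->
  absolutely_continuous_on a b F.
Proof.
move=> M0 FM e e0; have M1 : 0 < M + 1 by rewrite ltr_wpDl.
(* [M + 1] keeps the denominator positive when [M = 0]. *)
exists (e / (M + 1)); first by rewrite divr_gt0.
move=> n x y xy _; rewrite ltr_pdivlMr// mulrC; apply: le_lt_trans.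
rewrite mulr_sumr; apply: ler_sum => i _; apply: (le_trans (FM _ _)).
have [_ [xyi _]] := xy i; rewrite ger0_norm ?subr_ge0//.
by rewrite ler_wpM2r ?subr_ge0// lerDl.
Qed.

(** Families of a single interval already give continuity within [[a, b]]. *)
Lemma absolutely_continuous_near (R : realType) (a b : R) (F : R -> R)
    (x e : R) :
  absolutely_continuous_on a b F -> a <= x <= b -> 0 < e ->
  exists2 d, 0 < d & forall y, a <= y <= b -> `|y - x| < d -> `|F y - F x| < e.
Proof.
move=> acF /andP[ax xb] e0; have [d d0 dP] := acF e e0; exists d => //.
have dP1 s t : a <= s -> s <= t -> t <= b -> t - s < d -> `|F t - F s| < e.
  move=> as_ st tb std.
  have := dP 1%N (fun=> s) (fun=> t); rewrite !big_ord_recl !big_ord0 !addr0.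
  by apply => //; move=> i j _ _ _; rewrite !ord1.
move=> y /andP[ay yb]; have [xy|/ltW yx] := leP x y.
  by rewrite ger0_norm ?subr_ge0// => ?; exact: dP1.
by rewrite distrC ger0_norm ?subr_ge0// distrC => ?; exact: dP1.
Qed.

(** If the values differed at [x], each function moving by less than half the gap would keep them
    apart on a nondegenerate interval, which a null set cannot contain. *)
Lemma absolutely_continuous_ae_eq (R : realType) (a b : R) (F H : R -> R)
    (x : R) :
  a < b -> absolutely_continuous_on a b F -> absolutely_continuous_on a b H ->
  ae_eq (@lebesgue_measure R) `[a, b]%classic F H -> a <= x <= b -> F x = H x.
Proof.
move=> ab acF acH [N [mN N0 FHN]] xab; apply: contrapT => /eqP FHx.
have e0 : 0 < `|F x - H x| / 2 by rewrite divr_gt0// normr_gt0 subr_eq0.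
have [d1 d10 d1P] := absolutely_continuous_near R a b F x _ acF xab e0.
have [d2 d20 d2P] := absolutely_continuous_near R a b H x _ acH xab e0.
have d0 : 0 < Num.min d1 d2 by rewrite lt_min d10.
have [p [q [pq ap qb pqP]]] := subitv_near R a b x _ ab xab d0.
have pqN : `[p, q]%classic `<=` N.
  move=> y; rewrite /= in_itv/= => ypq; apply: FHN => /= FHy.
  have /andP[py yq] := ypq.
  have yab : a <= y <= b by rewrite (le_trans ap py) (le_trans yq qb).
  have := pqP y ypq; rewrite lt_min => /andP[/(d1P y yab) + /(d2P y yab)].
  rewrite FHy; last by rewrite in_itv.
  have := ler_normD (F x - H y) (H y - H x).
  by rewrite addrA subrK (distrC (F x) (H y)); lra.
have : (lebesgue_measure (`[p, q]%classic : set R) <= 0)%E.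
  by rewrite -N0; apply: le_measure => //; rewrite inE.
by rewrite lebesgue_measure_itv/= lte_fin pq lee_fin; lra.
Qed.

(** The representative picked by [xget] agrees with [F] on all of [[a, b]] by uniqueness, so the
    derivative can be computed on [F]. *)
Lemma frac_deriv_eq (R : realType) (a b alpha : R) (f F : R -> R) (x l : R) :
  a < b -> absolutely_continuous_on a b F ->
  (forall y, a <= y <= b -> frac_int a alpha f y = F y) -> a <= x <= b ->
  (forall e, 0 < e -> exists2 d, 0 < d & forall y, a <= y <= b ->
     `|y - x| < d -> `|F y - F x - l * (y - x)| <= e * `|y - x|) ->
  frac_deriv a b alpha f x = l.
Proof.
move=> ab acF fF xab Fl.
have rF : is_ac_representative a b (frac_int a alpha f) F.
  split => //; apply: aeW => y; rewrite /= in_itv/= => yab.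
  by rewrite fF.
rewrite /frac_deriv; set H := ac_representative _ _ _.
have [acH HJ] : is_ac_representative a b (frac_int a alpha f) H.
  exact: (xgetPex _ (ex_intro _ F rF)).
have FH y : a <= y <= b -> H y = F y.
  apply: absolutely_continuous_ae_eq => //.
  by apply: ae_eq_trans HJ _; apply: ae_eq_sym; exact: rF.2.
apply: deriv_on_eq => // e e0; have [d d0 dP] := Fl e e0.
by exists d => // y yab yx; rewrite !FH//; exact: dP.
Qed.

(** * Extension of [f] and its derivative to the line *)

Section V_extension.
Variables (R : realType) (a b : R) (f : R -> R).
Hypotheses (ab : a < b) (Vf : V a b f).

Let f0 := f \o clamp R a b.
Let g0 := deriv_on a b f \o clamp R a b.
Let leab := ltW ab.

Lemma V_deriv_onP x : a <= x <= b -> forall e, 0 < e ->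
  exists2 d, 0 < d & forall y, a <= y <= b ->
     `|y - x| < d ->
     `|f y - f x - deriv_on a b f x * (y - x)| <= e * `|y - x|.
Proof.
by move=> xab; apply: deriv_onP; apply: Vf.1.1; rewrite in_itv.
Qed.

Lemma continuous_V_deriv : continuous g0.
Proof. by apply: continuous_clamp => //; exact: Vf.1.2. Qed.

Lemma continuous_V : continuous f0.
Proof.
apply: continuous_clamp => //; apply/subspace_continuousP => x.
rewrite /= in_itv/= => xab; apply/cvgrPdist_le => e e0.
(* The expansion with error 1 gives the local Lipschitz constant [1 + |l|] at [x]. *)
have [d d0 dP] := V_deriv_onP x xab 1 ltr01.
rewrite near_withinE; set l := deriv_on a b f x in dP.
have l0 : 0 < 1 + `|l| by rewrite ltr_pwDl.
exists (Num.min d (e / (1 + `|l|))) => /=; first by rewrite lt_min d0 divr_gt0.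
move=> y /=; rewrite lt_min distrC => /andP[yd ye]; rewrite in_itv/= => yab.
have := dP y yab yd; rewrite mul1r => fyx.
rewrite distrC -(subrK (l * (y - x)) (f y - f x)).
apply: (le_trans (ler_normD _ _)); rewrite normrM.
move: ye; rewrite ltr_pdivlMr// mulrDr mulr1 (mulrC `|y - x| `|l|) => /ltW.
by apply: le_trans; rewrite lerD2r.
Qed.

(** Locating [c] by its distance to [x] treats both orders of [x] and [y] at once and is all that
    the uniform estimates use. *)
Lemma V_mean_value x y : a <= x <= b -> a <= y <= b ->
  exists2 c, `|c - x| <= `|y - x| & f0 y - f0 x = g0 c * (y - x).
Proof.
move=> xab yab.
have dfg z : z \in `]a, b[%R -> is_derive z 1 f0 (g0 z).
  rewrite in_itv/= => /andP[az zb]; apply: is_derive1_linear_approx => e e0.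
  have zab : a <= z <= b by rewrite !ltW.
  have [d d0 dP] := V_deriv_onP z zab e e0.
  (* Staying closer to [z] than the end points keeps [t] in [[a, b]], where the projection is the
     identity. *)
  exists (Num.min d (Num.min (z - a) (b - z))).
    by rewrite !lt_min d0 !subr_gt0 az zb.
  move=> t; rewrite !lt_min => /and3P[td ta tb].
  have tab : a <= t <= b.
    move: ta tb; rewrite !ltr_norml => /andP[? ?] /andP[? ?].
    by apply/andP; lra.
  by rewrite /f0 /g0 /= !clamp_id//; exact: dP.
have MV s t : a <= s -> s <= t -> t <= b ->
    exists2 c, c \in `[s, t]%R & f0 t - f0 s = g0 c * (t - s).
  move=> as_ st tb.
  have dfst z : z \in `]s, t[%R -> is_derive z 1 f0 (g0 z).
    rewrite in_itv/= => /andP[sz zt]; apply: dfg; rewrite in_itv/=.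
    by rewrite (le_lt_trans as_)// (lt_le_trans zt).
  have cst : {within `[s, t], continuous f0}.
    by apply: continuous_subspaceT; exact: continuous_V.
  exact: (MVT_segment st dfst cst).
have /andP[ax xb] := xab; have /andP[ay yb] := yab.
have [xy|/ltW yx] := leP x y.
  have [c] := MV x y ax xy yb; rewrite in_itv/= => /andP[xc cy] fc.
  by exists c => //; rewrite !ger0_norm ?subr_ge0// lerD2r.
have [c] := MV y x ay yx xb; rewrite in_itv/= => /andP[yc cx] fc.
exists c; first by rewrite !ler0_norm ?subr_le0// lerN2 lerD2r.
by rewrite -[RHS]opprK -mulrN opprB -fc opprB.
Qed.

(** The modulus on [[a, b]] remains valid on the line because the projection does not increase
    distances. *)
Lemma V_uniform_continuity e : 0 < e -> exists2 d, 0 < d &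
  forall x y, `|y - x| < d -> `|g0 y - g0 x| <= e.
Proof.
move=> e0.
have [d d0 dP] := uniform_continuity_itv R a b g0 continuous_V_deriv e e0.
exists d => // x y yx.
have := dP (clamp R a b x) (clamp R a b y) (clamp_bound R a b x leab).
rewrite /g0/= !(clamp_id R a b (clamp R a b _)) ?clamp_bound//; apply.
by apply: le_lt_trans yx; exact: clamp_lipschitz.
Qed.

Lemma V_bounded : exists2 M, 0 <= M & forall x,
  `|f0 x| <= M /\ `|g0 x| <= M.
Proof.
have [M1 M1P] := bounded_itv R a b f0 leab continuous_V.
have [M2 M2P] := bounded_itv R a b g0 leab continuous_V_deriv.
exists (`|M1| + `|M2|); first by rewrite addr_ge0.
move=> x; have cx := clamp_bound R a b x leab.
have := M1P _ cx; have := M2P _ cx; rewrite /f0 /g0 /= clamp_id// => g2 f1.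
have := ler_norm M1; have := ler_norm M2.
have := normr_ge0 M1; have := normr_ge0 M2; split; lra.
Qed.

Lemma V_lipschitz : exists2 M, 0 <= M & forall x y,
  `|f0 y - f0 x| <= M * `|y - x|.
Proof.
have [M M0 MP] := V_bounded; exists M => // x y.
have [c _] := V_mean_value _ _ (clamp_bound R a b x leab)
  (clamp_bound R a b y leab).
rewrite /f0 /= !(clamp_id R a b (clamp R a b _)) ?clamp_bound// => ->.
rewrite normrM; apply: ler_pM => //; last exact: clamp_lipschitz.
by case: (MP c).
Qed.

(* Where clamping changes an increment, [g0 x] is small: x lies outside [a, b],
   where g0 = 0, or within |y - x| of an end point, where g0 vanishes. *)
Lemma V_linear_approx e : 0 < e -> exists2 d, 0 < d &
  forall x y, `|y - x| < d ->
    `|f0 y - f0 x - g0 x * (y - x)| <= e * `|y - x|.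
Proof.
(* One third pays for the variation of [g0] between [x] and the mean value point, two thirds for the
   clamping defect, of size at most [2 * |y - x|]. *)
move=> e0; have [d d0 dP] := V_uniform_continuity (e / 3) ltac:(lra).
have [_ [[fa ga] [fb gb]]] := Vf.
exists d => // x y yx.
pose cx := clamp R a b x; pose cy := clamp R a b y.
have cyx : `|cy - cx| <= `|y - x| by exact: clamp_lipschitz.
have [c cP] := V_mean_value _ _ (clamp_bound R a b x leab)
  (clamp_bound R a b y leab).
rewrite /f0 /= !(clamp_id R a b (clamp R a b _)) ?clamp_bound// -/cx -/cy => fE.
have g0x : g0 x = g0 cx by rewrite /g0/= (clamp_id R a b cx) ?clamp_bound.
have gc : `|g0 c - g0 cx| <= e / 3.
  by apply: dP; apply: (le_lt_trans cP); exact: le_lt_trans yx.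
have gx : `|g0 x * ((y - x) - (cy - cx))| <= e / 3 * (2 * `|y - x|).
  have cxy : `|(y - x) - (cy - cx)| <= 2 * `|y - x|.
    by apply: (le_trans (ler_normB _ _)); lra.
  have g0N z : z <= a \/ b <= z -> g0 z = 0.
    by case=> [za|bz]; rewrite /g0/=;
      [rewrite (clamp_left R a b z)|rewrite (clamp_right R a b z)].
  have [xN|xI] := pselect (x <= a \/ b <= x).
    by rewrite (g0N x xN) mul0r normr0 mulr_ge0 ?mulr_ge0//; lra.
  have /andP[ax xb] : (a < x) && (x < b).
    by apply/andP; split; rewrite ltNge; apply/negP => xx; apply: xI;
      [left|right].
  have [yN|yI] := pselect (y <= a \/ b <= y).
    rewrite normrM; apply: ler_pM => //.
    by have := dP x y yx; rewrite (g0N y yN) sub0r normrN.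
  have /andP[ay yb] : (a < y) && (y < b).
    by apply/andP; split; rewrite ltNge; apply/negP => yy; apply: yI;
      [left|right].
  rewrite /cx /cy !clamp_id ?(ltW ax) ?(ltW xb) ?(ltW ay) ?(ltW yb)//.
  by rewrite subrr mulr0 normr0 mulr_ge0 ?mulr_ge0//; lra.
rewrite fE.
(* The error splits into the variation of the slope on the clamped increment and the slope times the
   clamping defect. *)
have -> : g0 c * (cy - cx) - g0 x * (y - x) =
    (g0 c - g0 cx) * (cy - cx) - g0 x * ((y - x) - (cy - cx)).
  by rewrite g0x; ring.
apply: (le_trans (ler_normB _ _)); rewrite normrM.
have : `|g0 c - g0 cx| * `|cy - cx| <= e / 3 * `|y - x| by apply: ler_pM.
lra.
Qed.

(** * Means of [f0] and [g0] along [x - alpha * u] *)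

Let mean_f (alpha x : R) := E1_mean R (fun u => f0 (x - alpha * u)).
Let mean_g (alpha x : R) := E1_mean R (fun u => g0 (x - alpha * u)).

Let measurable_sample (h : R -> R) (alpha x : R) : continuous h ->
  measurable_fun [set: R] (fun u => h (x - alpha * u)).
Proof.
move=> /continuous_measurable_fun mh; apply: measurableT_comp => //.
by apply: measurable_funB => //; exact: measurable_funM.
Qed.

Let mf alpha x := measurable_sample f0 alpha x continuous_V.
Let mg alpha x := measurable_sample g0 alpha x continuous_V_deriv.

(** The condition [f a = 0] makes [f0] vanish to the left of [a], as the substitution requires. *)
Lemma frac_int_V alpha x : 0 < alpha -> a <= x <= b ->
  frac_int a alpha f x = mean_f alpha x.
Proof.
move=> alpha0 /andP[ax xb]; have [_ [[fa _] _]] := Vf.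
apply: frac_int_E1_mean => //.
- by apply: continuous_measurable_fun; exact: continuous_V.
- by move=> t /ltW ta; rewrite /f0/= clamp_left.
- by move=> t /andP[at_ tx]; rewrite /f0/= clamp_id// at_ (le_trans tx).
Qed.

(** The shift [alpha * u] cancels in increments, so the Lipschitz constant of [f0] survives
    averaging. *)
Lemma mean_f_lipschitz : exists2 M, 0 <= M & forall alpha x y,
  `|mean_f alpha y - mean_f alpha x| <= M * `|y - x|.
Proof.
have [M M0 MP] := V_lipschitz.
have [B B0 BP] := V_bounded.
exists M => // alpha x y.
have bf z u : 0 <= u -> `|f0 (z - alpha * u)| <= B + 0 * u.
  by move=> _; rewrite mul0r addr0; case: (BP (z - alpha * u)).
rewrite /mean_f -(E1_meanB R B 0 B 0 _ _
  (lexx 0) (mf _ _) (bf y) (lexx 0) (mf _ _) (bf x)).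
rewrite -[leRHS]addr0; apply: le_norm_E1_mean => //.
  exact: measurable_funB.
move=> u _; rewrite mul0r addr0; apply: (le_trans (MP _ _)).
by rewrite opprB addrA subrK.
Qed.

(** The radius for [f0] is the same at every base point, so the expansions at all [x - alpha * u]
    hold together and can be averaged; unit mass keeps the error [e]. *)
Lemma mean_f_linear_approx e : 0 < e -> exists2 d, 0 < d &
  forall alpha x y, `|y - x| < d ->
    `|mean_f alpha y - mean_f alpha x - mean_g alpha x * (y - x)|
      <= e * `|y - x|.
Proof.
move=> e0; have [d d0 dP] := V_linear_approx e e0.
have [B B0 BP] := V_bounded.
exists d => // alpha x y yx.
have bf z u : 0 <= u -> `|f0 (z - alpha * u)| <= B + 0 * u.
  by move=> _; rewrite mul0r addr0; case: (BP (z - alpha * u)).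
have bg z u : 0 <= u -> `|g0 (z - alpha * u)| <= B + 0 * u.
  by move=> _; rewrite mul0r addr0; case: (BP (z - alpha * u)).
rewrite /mean_f /mean_g.
rewrite -(E1_meanB R B 0 B 0 _ _
  (lexx 0) (mf _ _) (bf y) (lexx 0) (mf _ _) (bf x)).
rewrite -(E1_meanZr R B 0 _ _ (lexx 0) (mg _ _) (bg x)).
rewrite -(E1_meanB R (B + B) 0 (B * `|y - x|) 0)//; last 4 first.
- exact: measurable_funB.
- move=> u u0; rewrite mul0r addr0; apply: (le_trans (ler_normB _ _)).
  by apply: lerD; [have := bf y u u0|have := bf x u u0]; rewrite mul0r addr0.
- exact: measurable_funM.
- move=> u u0; rewrite mul0r addr0 normrM ler_wpM2r//.
  by have := bg x u u0; rewrite mul0r addr0.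
rewrite -[leRHS]addr0; apply: le_norm_E1_mean => //.
  by apply: measurable_funB; [exact: measurable_funB|exact: measurable_funM].
have yxE u : y - alpha * u - (x - alpha * u) = y - x.
  by rewrite opprB addrA subrK.
move=> u _; rewrite mul0r addr0 -{1 2}(yxE u); apply: dP.
by rewrite yxE.
Qed.

(** Provides the measurability of the integrand in the L1 estimate. *)
Lemma continuous_mean_g alpha : continuous (mean_g alpha).
Proof.
have [B B0 BP] := V_bounded.
have bg z u : 0 <= u -> `|g0 (z - alpha * u)| <= B + 0 * u.
  by move=> _; rewrite mul0r addr0; case: (BP (z - alpha * u)).
move=> x; apply/cvgrPdist_le => e e0.
have [d d0 dP] := V_uniform_continuity e e0.
exists d => // y /= yx; rewrite /mean_g -(E1_meanB R B 0 B 0 _ _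
  (lexx 0) (mg _ _) (bg x) (lexx 0) (mg _ _) (bg y)).
rewrite -[leRHS]addr0; apply: le_norm_E1_mean => //.
  exact: measurable_funB.
move=> u _; rewrite mul0r addr0; apply: dP.
by rewrite opprB addrA subrK.
Qed.

(* Uniform continuity up to [e], with the defect absorbed in a linear term
   whose E1-mean is controlled by the first moment of E1. *)
Lemma mean_g_near e : 0 < e -> exists2 C, 0 <= C & forall alpha x, 0 < alpha ->
  `|mean_g alpha x - g0 x| <= e + C * alpha.
Proof.
move=> e0; have [d d0 dP] := V_uniform_continuity e e0.
have [B B0 BP] := V_bounded.
have C0 : 0 <= 2 * B / d by rewrite divr_ge0 ?mulr_ge0// ltW.
exists (2 * B / d) => // alpha x alpha0.
have bg u : 0 <= u -> `|g0 (x - alpha * u)| <= B + 0 * u.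
  by move=> _; rewrite mul0r addr0; case: (BP (x - alpha * u)).
have bc u : 0 <= u -> `|cst (g0 x) u| <= B + 0 * u.
  by move=> _; rewrite mul0r addr0; case: (BP x).
rewrite /mean_g -[X in _ - X](E1_mean_cst R).
rewrite -(E1_meanB R B 0 B 0 _ _ (lexx 0) (mg _ _) bg (lexx 0) _ bc)//.
apply: le_norm_E1_mean; first by rewrite mulr_ge0// ltW.
  exact: measurable_funB.
move=> u u0; have au0 : 0 <= alpha * u by rewrite mulr_ge0// ltW.
(* For a shift below [d] the oscillation is at most [e]; otherwise it is at most [2 * B], hence at
   most [2 * B / d] times the shift. *)
rewrite -(mulrA _ alpha); have [aud|dau] := ltP (alpha * u) d.
  apply: (@le_trans _ _ e); last by rewrite lerDl mulr_ge0.
  by apply: dP; rewrite addrC addKr normrN ger0_norm.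
apply: (@le_trans _ _ (2 * B)).
  have [_ g1] := BP (x - alpha * u); have [_ g2] := BP x.
  by apply: (le_trans (ler_normB _ _)); rewrite /g0/= in g1 g2 *; lra.
rewrite -[leLHS]add0r; apply: lerD; first exact: ltW.
by rewrite -[leLHS](divfK (lt0r_neq0 d0)) ler_wpM2l.
Qed.

(** * The fractional derivative and its L1 limit *)

Lemma has_ac_representative_V alpha : 0 < alpha ->
  has_ac_representative a b (frac_int a alpha f).
Proof.
move=> alpha0; have [M M0 MP] := mean_f_lipschitz.
exists (mean_f alpha); split.
  exact: lipschitz_absolutely_continuous (MP alpha).
by apply: aeW => y; rewrite /= in_itv/= => yab; rewrite frac_int_V.
Qed.

Lemma frac_deriv_V alpha x : 0 < alpha -> a <= x <= b ->
  frac_deriv a b alpha f x = mean_g alpha x.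
Proof.
move=> alpha0 xab; have [M M0 MP] := mean_f_lipschitz.
apply: (frac_deriv_eq R a b alpha f (mean_f alpha)) => //.
- exact: lipschitz_absolutely_continuous (MP alpha).
- by move=> y yab; exact: frac_int_V.
- move=> e e0; have [d d0 dP] := mean_f_linear_approx e e0.
  by exists d => // y _; exact: dP.
Qed.

(** A uniform bound on [[a, b]] is multiplied by the length; [C] depends on [e] but not on
    [alpha]. *)
Lemma L1_norm_V_le e : 0 < e -> exists2 C, 0 <= C & forall alpha, 0 < alpha ->
  (L1_norm a b (fun x => frac_deriv a b alpha f x - deriv_on a b f x)%R
   <= ((e + C * alpha) * (b - a))%:E)%E.
Proof.
move=> e0; have [C C0 CP] := mean_g_near e e0; exists C => // alpha alpha0.
rewrite /L1_norm Lnorm1.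
rewrite (_ : (\int[_]_x _)%E = (\int[@lebesgue_measure R]_(x in `[a, b])
    `|mean_g alpha x - g0 x|%R%:E)%E); last first.
  rewrite [RHS]integral_mkcond; apply: eq_integral => x _; rewrite !patchE.
  case: ifPn => [|_]; last by rewrite abse0.
  rewrite inE/= in_itv/= => xab.
  by rewrite frac_deriv_V// /g0/= clamp_id.
have -> : ((e + C * alpha) * (b - a))%:E =
    (\int[@lebesgue_measure R]_(x in `[a, b]) cst (e + C * alpha)%:E x)%E.
  by rewrite integral_cst//= lebesgue_measure_itv/= lte_fin ab.
apply: ge0_le_integral => //.
- apply/measurable_EFinP/measurable_funTS/measurableT_comp => //.
  apply: measurable_funB; apply: continuous_measurable_fun.
    exact: continuous_mean_g.
  exact: continuous_V_deriv.
- by move=> x _; rewrite lee_fin; exact: CP.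
Qed.

Lemma cvg_L1_norm_V :
  L1_norm a b (fun x => frac_deriv a b alpha f x - deriv_on a b f x)
    @[alpha --> (0 : R)^'+] --> 0%E.
Proof.
have ba0 : 0 < b - a by rewrite subr_gt0.
have N0 alpha : (0 <= L1_norm a b
    (fun x => frac_deriv a b alpha f x - deriv_on a b f x)%R)%E.
  exact: Lnorm_ge0.
apply/fine_cvgP; split.
  (* Any fixed error, here 1, shows that the norm is finite. *)
  have [C _ CP] := L1_norm_V_le 1 ltr01.
  near=> alpha; rewrite ge0_fin_numE//.
  have alpha0 : 0 < alpha by near: alpha; exact: nbhs_right_gt.
  by apply: (le_lt_trans (CP alpha alpha0)); exact: ltry.
apply/cvgrPdist_le => e e0.
(* After multiplication by [b - a] this is half of the tolerance; [C * alpha] gets the other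
   half. *)
have e10 : 0 < e / (2 * (b - a)) by rewrite divr_gt0// mulr_gt0.
have [C C0 CP] := L1_norm_V_le _ e10.
have C1 : 0 < C + 1 by rewrite ltr_wpDl.
near=> alpha.
have alpha0 : 0 < alpha by near: alpha; exact: nbhs_right_gt.
have Ca : C * alpha <= e / (2 * (b - a)).
  apply: (@le_trans _ _ ((C + 1) * alpha)).
    by rewrite ler_wpM2r ?lerDl// ltW.
  rewrite mulrC -ler_pdivlMr//; apply: ltW; near: alpha.
  by apply: nbhs_right_lt; rewrite divr_gt0.
rewrite sub0r normrN /= ger0_norm ?fine_ge0//.
have Ne := CP alpha alpha0.
rewrite -lee_fin fineK; last by rewrite ge0_fin_numE// (le_lt_trans Ne)// ltry.
apply: (le_trans Ne); rewrite lee_fin.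
apply: (@le_trans _ _ ((e / (2 * (b - a)) + e / (2 * (b - a))) * (b - a))).
  by rewrite ler_wpM2r ?lerD2l// ltW.
rewrite le_eqVlt; apply/orP; left; apply/eqP; field.
by rewrite gt_eqF.
Unshelve. all: by end_near. Qed.

End V_extension.

Theorem theorem4p1 (R : realType) (a b : R) (f : R -> R)
    (hab : a < b) (hf : V a b f) :
  (forall alpha : R, 0 < alpha ->
     has_ac_representative a b (frac_int a alpha f)) /\
  L1_norm a b (fun x => frac_deriv a b alpha f x - deriv_on a b f x)
    @[alpha --> (0 : R)^'+] --> 0%E.
Proof.
split; first by move=> alpha; exact: has_ac_representative_V.
exact: cvg_L1_norm_V.
Qed.
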